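(* If $G$ is a graph having two vertices $u$ and $v$ such that $\deg(u)=1$, $\deg(v)=2$ and $d(u,v)=2$, then $G$ is not group vertex magic.
   Context: Graphs are finite, simple and undirected; $d(u,v)$ is the distance; in this part of the paper all Abelian groups are finite. For an additive Abelian group $\Gamma$ with identity $0$ and a graph $G$, a $\Gamma$-vertex magic labeling is a map $\ell:V(G)\to\Gamma\setminus\{0\}$ for which there is $\mu\in\Gamma$ with $w(v)=\sum_{y\in N(v)}\ell(y)=\mu$ for every vertex $v$; $G$ is group vertex magic if it is $\Gamma$-vertex magic for every nontrivial Abelian group $\Gamma$. *)

(* Defs.v *)
From mathcomp Require Import all_boot all_order all_algebra.

Set Implicit Arguments.
Unset Strict Implicit.
Unset Printing Implicit Defensive.

Import GRing.Theory.
Local Open Scope ring_scope.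

Record sgraph := SGraph {
  vertex :> finType;
  adj : rel vertex;
  adj_sym : symmetric adj;
  adj_irrefl : irreflexive adj
}.

Definition nbh (G : sgraph) (v : G) : {set G} := [set y | adj v y].

Definition deg (G : sgraph) (v : G) : nat := #|nbh v|.

Definition walk (G : sgraph) (u v : G) (n : nat) : Prop :=
  exists p : seq G, [/\ path (@adj G) u p, last u p = v & size p = n].

(* The distance is kept as a relation, so that no value has to be assigned to
   vertices in different components. *)
Definition is_dist (G : sgraph) (u v : G) (n : nat) : Prop :=
  walk u v n /\ (forall m : nat, walk u v m -> (n <= m)%N).

Definition weight (Gamma : finZmodType) (G : sgraph) (l : G -> Gamma) (v : G)
  : Gamma := \sum_(y in nbh v) l y.

Definition vertex_magic_labeling (Gamma : finZmodType) (G : sgraph)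
    (l : G -> Gamma) : Prop :=
  (forall v : G, l v != 0) /\
  (exists mu : Gamma, forall v : G, weight l v = mu).

Definition vertex_magic (Gamma : finZmodType) (G : sgraph) : Prop :=
  exists l : G -> Gamma, vertex_magic_labeling l.

Definition group_vertex_magic (G : sgraph) : Prop :=
  forall Gamma : finZmodType, (1 < #|Gamma|)%N -> vertex_magic Gamma G.

(* Main.v *)
Require Import Defs.
From mathcomp Require Import all_boot all_order all_algebra.

(* If c is the neighbour of u, then c is also a neighbour of v, and
   w(v) = l(c) + l(d) = w(u) + l(d) for the second neighbour d of v.
   A constant weight thus forces l(d) = 0, whatever the group is. *)

Import GRing.Theory.
Local Open Scope ring_scope.

Lemma walk2P (G : sgraph) (u v : G) :
  walk u v 2 -> exists2 c : G, adj u c & adj c v.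
Proof.
(* The size condition leaves only the two-vertex list [[:: c; y]], whose last vertex [y] is [v]. *)
case=> -[|c [|y [|z s]]] [] //=.
by case/and3P=> uc cy _ <- _; exists c.
Qed.

Lemma not_vertex_magic_dist2 (Gamma : finZmodType) (G : sgraph) (u v : G) :
  deg u = 1%N -> deg v = 2%N -> walk u v 2 -> ~ vertex_magic Gamma G.
Proof.
move=> du dv /walk2P[c uc cv] [l [l_neq0 [mu w_mu]]].
have c_u : c \in nbh u by rewrite inE.
have c_v : c \in nbh v by rewrite inE adj_sym.
have Nu : nbh u = [set c].
  by apply/esym/eqP; rewrite eqEcard sub1set c_u cards1 -/(deg u) du.
(* Since [c] is one of the two neighbours of [v], removing it leaves exactly one, the [d] whose
   label is forced to be 0. *)
have /cards1P[d Nv] : #|nbh v :\ c| == 1%N.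
  by move/eqP: dv; rewrite /deg (cardsD1 c) c_v add1n eqSS.
have wu : weight l u = l c by rewrite /weight Nu big_set1.
have wv : weight l v = l c + l d.
  by rewrite /weight (big_setD1 c) //= Nv big_set1.
have /eqP := l_neq0 d; apply.
by apply: (addrI (l c)); rewrite addr0 -wv -wu !w_mu.
Qed.

Theorem theorem2p3 (G : sgraph) (u v : G) :
  deg u = 1%N -> deg v = 2%N -> is_dist u v 2 -> ~ group_vertex_magic G.
Proof.
move=> du dv [uv _] magicG.
(* One nontrivial group without a labeling suffices; the witness is the smallest, ['I_2] with
   addition modulo 2. *)
apply: (@not_vertex_magic_dist2 'I_2 _ _ _ du dv uv).
by apply: magicG; rewrite card_ord.
Qed.
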